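(* Let $n$ and $k$ be integers with $2\le k\le n-2$, and let $\Re(n,k)$ be the set of connected graphs of order $n$ with exactly $k$ pendant vertices. If $G\in\Re(n,k)$ satisfies $\rho_Q(G)=\max\{\rho_Q(G'):G'\in\Re(n,k)\}$, then $G\in\mathfrak{D}(n,k)$, i.e. $G\cong T(n,k;t_1,t_2)$ for some integers $t_1\ge1$, $t_2\ge1$ with $t_1+t_2=k$.
   Context: All graphs are simple and finite. For a connected graph $G$ with vertex set $\{v_1,\dots,v_n\}$, $d_G(u,v)$ is the distance, $Tr_G(u)=\sum_{v}d_G(u,v)$ is the transmission, $Tr(G)$ is the diagonal matrix of transmissions and $D(G)=(d_G(v_i,v_j))$ is the distance matrix. The distance signless Laplacian matrix is $Q_D(G)=Tr(G)+D(G)$ and $\rho_Q(G)$ is its largest eigenvalue. A pendant vertex is a vertex of degree $1$. For integers $t_1,t_2\ge1$ with $t_1+t_2=k$ and $\ell=n-k\ge2$, $T(n,k;t_1,t_2)$ denotes the tree obtained from a path $P_\ell$ of order $\ell$ by attaching $t_1$ pendant vertices to one end vertex of the path and $t_2$ pendant vertices to the other end vertex. $\mathfrak{D}(n,k)=\{T(n,k;t_1,t_2): t_1\ge1,\ t_2\ge1,\ t_1+t_2=k\}$. *)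

(* Defs.v *)
From HB Require Import structures.
From mathcomp Require Import all_boot all_order all_algebra.
From mathcomp Require Import spectral complex polyrcf.
From mathcomp Require Import reals.
From mathcomp Require classical_sets.

Set Implicit Arguments.
Unset Strict Implicit.
Unset Printing Implicit Defensive.
Import Order.TTheory GRing.Theory Num.Theory.
Local Open Scope ring_scope.

Record sgraph (V : finType) := SGraph {
  edge : rel V;
  edge_sym : symmetric edge;
  edge_irr : irreflexive edge }.

Definition graph_iso (V W : finType) (G : sgraph V) (H : sgraph W) : Prop :=
  exists2 f : V -> W, bijective f & forall u v, edge H (f u) (f v) = edge G u v.

Section Graph.
Variables (V : finType) (G : sgraph V).

Definition connected : Prop := forall u v, connect (edge G) u v.

Definition degree (v : V) : nat := #|[set u | edge G v u]|.

Definition pendant (v : V) : bool := degree v == 1%N.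

Definition walk_of_length (u v : V) (m : nat) : bool :=
  [exists p : m.-tuple V, path (edge G) u p && (last u p == v)].

(* The least length of a walk from u to v.  A shortest walk has length smaller
   than the order #|V|, so the search over 0, ..., #|V| - 1 is exhaustive;
   #|V| is returned when u and v are not connected. *)
Definition dist (u v : V) : nat := find (walk_of_length u v) (iota 0 #|V|).

Lemma dist_least u v p :
  path (edge G) u p -> last u p = v -> (dist u v <= size p)%N.
Proof.
move=> Gp pv; rewrite leqNgt; apply/negP => lt_pd.
have lt_pV: (size p < #|V|)%N.
  by rewrite (leq_trans lt_pd) // -[leqRHS](size_iota 0) find_size.
have := before_find 0%N lt_pd; rewrite nth_iota // add0n => /existsP; apply.
by exists (in_tuple p); rewrite Gp pv eqxx.
Qed.

Lemma dist_attained u v : connect (edge G) u v ->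
  exists p, [/\ path (edge G) u p, last u p = v & size p = dist u v].
Proof.
case/connectP => q Gq ->; case/shortenP: Gq => p Gp Up _.
have lt_pV: (size p < #|V|)%N.
  by rewrite -[(size p).+1]/(size (u :: p)) -(card_uniqP Up) max_card.
have hasW: has (walk_of_length u (last u p)) (iota 0 #|V|).
  apply/hasP; exists (size p); first by rewrite mem_iota.
  by apply/existsP; exists (in_tuple p); rewrite Gp eqxx.
have := nth_find 0%N hasW; rewrite -/(dist u (last u p)) nth_iota; last first.
  by rewrite -[ltnRHS](size_iota 0) -has_find.
rewrite add0n => /existsP[r /andP[Gr /eqP lr]].
by exists r; rewrite size_tuple.
Qed.

Lemma dist_sym u v : dist u v = dist v u.
Proof.
suff walkS x y m : walk_of_length x y m -> walk_of_length y x m.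
  by apply: eq_find => m; apply/idP/idP; apply: walkS.
case/existsP => p /andP[Gp /eqP py]; apply/existsP.
have szp : size (rev (belast x p)) == m by rewrite size_rev size_belast size_tuple.
exists (Tuple szp); rewrite /= -py rev_path.
rewrite (eq_path (e' := edge G)) ?Gp; last by move=> a b; rewrite edge_sym.
by case: (tval p) => //= a q; rewrite rev_cons last_rcons.
Qed.

Definition transmission (u : V) : nat := (\sum_(v : V) dist u v)%N.

End Graph.

Section DistanceSignlessLaplacian.
Variables (R : realType) (n : nat).

Definition dist_mx (G : sgraph 'I_n) : 'M[R]_n := \matrix_(i, j) (dist G i j)%:R.

Definition transmission_mx (G : sgraph 'I_n) : 'M[R]_n :=
  diag_mx (\row_i (transmission G i)%:R).

Definition dist_signless_laplacian (G : sgraph 'I_n) : 'M[R]_n :=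
  transmission_mx G + dist_mx G.

Definition is_largest_eigenvalue (A : 'M[R]_n) (r : R) : Prop :=
  eigenvalue A r /\ forall s, eigenvalue A s -> s <= r.

(* The default value 0 is irrelevant for nonempty graphs: see rho_QP below. *)
Definition rho_Q (G : sgraph 'I_n) : R :=
  classical_sets.xget 0 (is_largest_eigenvalue (dist_signless_laplacian G)).

End DistanceSignlessLaplacian.

Lemma symmetric_eigenvalue_exists (R : realType) n (A : 'M[R]_n) :
  (0 < n)%N -> A^T = A -> exists a, eigenvalue A a.
Proof.
move=> n_gt0 symA; pose Ac := map_mx (real_complex R) A.
have [a /eigenvalueP[v vA v_neq0]] := eigenvalue_closed Ac n_gt0.
have symAc : map_mx Num.conj Ac^T = Ac.
  apply/matrixP => i j; rewrite !mxE -[in RHS]symA mxE.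
  by apply/eqP; rewrite eq_complex /= oppr0 !eqxx.
pose w := map_mx Num.conj v^T.
have wE : Ac *m w = Num.conj a *: w.
  by rewrite -{1}symAc /w -map_mxM -trmx_mul vA linearZ map_mxZ.
have : (v *m Ac *m w) = Num.conj a *: (v *m w).
  by rewrite -mulmxA wE -scalemxAr.
rewrite vA -scalemxAl => /(congr1 (fun M : 'M_1 => M 0 0)).
have vw_neq0 : (v *m w) 0 0 != 0.
  apply: contra v_neq0 => /eqP; rewrite mxE => vw0; apply/eqP/rowP => j.
  have vw_ge0 i : true -> 0 <= v 0 i * w i 0.
    by rewrite !mxE -normCK exprn_ge0.
  have /eqP := psumr_eq0P vw_ge0 vw0 (i := j) isT.
  by rewrite !mxE -normCK sqrf_eq0 normr_eq0 => /eqP.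
rewrite [LHS]mxE [RHS]mxE => /(mulIf vw_neq0) aR.
have aE : a = real_complex R (complex.Re a).
  have /CrealP/complex_realP[x ->] : Num.conj a = a by [].
  by [].
exists (complex.Re a); rewrite -(eigenvalue_map (real_complex R)) -[X in eigenvalue _ X]aE.
by apply/eigenvalueP; exists v.
Qed.

Lemma largest_eigenvalue_exists (R : realType) n (A : 'M[R]_n) :
  (0 < n)%N -> A^T = A -> exists r, is_largest_eigenvalue A r.
Proof.
move=> n_gt0 /(symmetric_eigenvalue_exists n_gt0)[a].
have char_neq0 : char_poly A != 0 by rewrite monic_neq0 ?char_poly_monic.
have eigA x : eigenvalue A x = (x \in rootsR (char_poly A)).
  by rewrite eigenvalue_root_char -(roots_on_rootsR char_neq0).
have max_seq (s : seq R) x : x \in s ->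
    exists2 r, r \in s & forall y, y \in s -> y <= r.
  elim: s x => // y [|z s] IHs x _.
    by exists y => [|t]; rewrite inE // => /eqP->.
  have [r rs le_r] := IHs z (mem_head z s).
  have [le_yr|lt_ry] := lerP y r.
    exists r => [|t]; first by rewrite inE rs orbT.
    by rewrite inE => /predU1P[->//|/le_r].
  exists y => [|t]; first exact: mem_head.
  by rewrite inE => /predU1P[->//|/le_r/le_trans->//]; apply: ltW.
rewrite eigA => /max_seq[r rA le_r].
by exists r; split=> [|x]; rewrite eigA //; apply: le_r.
Qed.

Lemma rho_QP (R : realType) n (G : sgraph 'I_n) :
  (0 < n)%N -> is_largest_eigenvalue (dist_signless_laplacian R G) (rho_Q R G).
Proof.
move=> n_gt0; apply: classical_sets.xgetPex.
apply: largest_eigenvalue_exists => //.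
rewrite linearD /= tr_diag_mx; congr (_ + _).
by apply/matrixP => i j; rewrite !mxE dist_sym.
Qed.

Definition graphs_with_pendants (n k : nat) (G : sgraph 'I_n) : Prop :=
  connected G /\ #|[set v | pendant G v]| = k.

Section Tree.
Variables l t1 t2 : nat.

(* inl: the vertices of the path P_l; inr (inl _): the t1 vertices attached to
   its first vertex; inr (inr _): the t2 vertices attached to its last one. *)
Definition tree_vertex : finType := ('I_l + ('I_t1 + 'I_t2))%type.

Definition tree_edge (x y : tree_vertex) : bool :=
  match x, y with
  | inl i, inl j => (i.+1 == j :> nat) || (j.+1 == i :> nat)
  | inl i, inr (inl _) | inr (inl _), inl i => i == 0 :> nat
  | inl i, inr (inr _) | inr (inr _), inl i => i.+1 == l
  | inr _, inr _ => false
  end.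

Lemma tree_edge_sym : symmetric tree_edge.
Proof. by move=> [i|[a|b]] [j|[c|d]] //=; rewrite orbC. Qed.

Lemma tree_edge_irr : irreflexive tree_edge.
Proof. by move=> [i|[a|b]] //=; rewrite gtn_eqF. Qed.

Definition path_with_pendants : sgraph tree_vertex :=
  SGraph tree_edge_sym tree_edge_irr.

End Tree.

Definition T (n k t1 t2 : nat) : sgraph (tree_vertex (n - k) t1 t2) :=
  path_with_pendants (n - k) t1 t2.

(* Main.v *)
Require Import Defs.
From mathcomp Require Import all_boot all_order all_algebra.
From mathcomp Require Import spectral complex sesquilinear.
From mathcomp Require Import boolp reals lra ring zify.
Import Order.TTheory GRing.Theory Num.Theory.
Local Open Scope ring_scope.

Set Implicit Arguments.
Unset Strict Implicit.
Unset Printing Implicit Defensive.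

(* The Perron vector x of Q_D(G) is positive and maximizes the quadratic form
   sum_{u<v} d(u,v) (x_u + x_v)^2 on its sphere, so no graph G' with
   rho_Q(G') <= rho_Q(G) can increase this form at x.  Compare G with all
   connected graphs having at least (rather than exactly) k pendant vertices.
   Deleting an edge of a cycle increases all distances weakly and creates no
   non-pendant vertex, so a maximal graph is a tree.  If a vertex v of the tree
   has three neighbors a, b, c, move the branch C at c from v to a, or to b: a
   pair y in C, z outside C changes its distance by d(a,z) - d(v,z), resp.
   d(b,z) - d(v,z).  These add up to at least 0, and to 2 for z = v, so one of
   the two moves increases the form.  The moves lose a pendant vertex only if a,
   resp. b, is pendant.  Hence a maximal tree has exactly k pendant vertices
   (otherwise it has maximum degree 2, and is a path), and each of its vertices
   of degree at least 3 has at most one non-pendant neighbor: it is a path with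
   pendant vertices at its ends. *)

(** * Rayleigh quotients *)

(** The complexification of [A] is Hermitian. In a unitary eigenbasis the form is the sum of
    [|y_i|^2] weighted by the eigenvalues, which are real and at most [r]. *)
Lemma rayleigh_le (R : rcfType) (n : nat) (A : 'M[R]_n) (r : R) :
  A^T = A -> (forall s, eigenvalue A s -> s <= r) ->
  forall x : 'rV_n, (x *m A *m x^T) 0 0 <= r * (x *m x^T) 0 0.
Proof.
move=> symA ler x; pose toC := real_complex R; pose Ac := map_mx toC A.
have toC_real (a : R) : Num.conj (toC a) = toC a.
  by apply/eqP; rewrite eq_complex /= oppr0 !eqxx.
have conjC_map m p (B : 'M_(m, p)) : map_mx Num.conj (map_mx toC B) = map_mx toC B.
  by apply/matrixP => i j; rewrite !mxE toC_real.
have hermAc : map_mx Num.conj Ac^T = Ac.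
  by rewrite /Ac map_trmx symA conjC_map.
have hAc : Ac \is hermsymmx.
  by apply/is_hermitianmxP; rewrite expr0 scale1r hermAc.
have nAc := hermitian_normalmx hAc.
pose P := spectralmx Ac; pose D := spectral_diag Ac.
have Punit : P \in unitmx by apply: spectral_unit.
have AcE : Ac = invmx P *m diag_mx D *m P by apply/orthomx_spectralP.
have PV : invmx P = map_mx Num.conj P^T by apply/invmx_unitary/spectral_unitarymx.
have eigD i : exists2 d, D 0 i = toC d & d <= r.
  have /mxOverP/(_ 0 i) := hermitian_spectral_diag_real hAc.
  case/complex_realP => d dE.
  exists d => //; apply: ler; rewrite -(eigenvalue_map toC).
  apply/eigenvalueP; exists (row i P).
    rewrite -row_mul -/Ac AcE !mulmxA mulmxV // mul1mx row_mul.
    by rewrite row_diag_mx -scalemxAl -rowE dE.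
  apply/eqP => P0; have : row_free P by rewrite row_free_unit.
  move=> /row_freeP[Q PQ].
  have := congr1 (fun M => row i M) PQ.
  rewrite row_mul P0 mul0mx => /rowP/(_ i)/eqP.
  by rewrite !mxE eqxx eq_sym oner_eq0.
pose y := map_mx toC x *m map_mx Num.conj P^T.
have yE : map_mx Num.conj y^T = P *m map_mx toC x^T.
  rewrite /y trmx_mul map_mxM /= -map_trmx.
  by congr (_ *m _); apply/matrixP => i j; rewrite !mxE ?conjCK ?toC_real.
have PVP : map_mx Num.conj P^T *m P = 1%:M by rewrite -PV mulVmx.
have normE : toC ((x *m x^T) 0 0) = \sum_i `|y 0 i| ^+ 2.
  have -> : toC ((x *m x^T) 0 0) = (y *m map_mx Num.conj y^T) 0 0.
    by rewrite yE /y mulmxA -(mulmxA _ _ P) PVP mulmx1 -map_mxM [RHS]mxE.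
  by rewrite mxE; apply: eq_bigr => i _; rewrite !mxE -normCK.
have formE : toC ((x *m A *m x^T) 0 0) = \sum_i D 0 i * `|y 0 i| ^+ 2.
  have -> : toC ((x *m A *m x^T) 0 0) = (y *m diag_mx D *m map_mx Num.conj y^T) 0 0.
    rewrite yE /y !mulmxA -PV -(mulmxA _ (invmx P)) -(mulmxA _ _ P) -AcE.
    by rewrite -!map_mxM [RHS]mxE.
  rewrite mul_mx_diag mxE; apply: eq_bigr => i _.
  by rewrite !mxE mulrAC -normCK mulrC.
suff : toC ((x *m A *m x^T) 0 0) <= toC (r * (x *m x^T) 0 0) by rewrite lecR.
have -> : toC (r * (x *m x^T) 0 0) = toC r * \sum_i `|y 0 i| ^+ 2.
  by rewrite -normE; apply: rmorphM.
rewrite formE mulr_sumr; apply: ler_sum => i _.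
by have [d -> ledr] := eigD i; rewrite ler_wpM2r ?exprn_ge0 // lecR.
Qed.

Lemma mx_formE (R : comRingType) (n : nat) (A : 'M[R]_n) (x : 'rV_n) :
  (x *m A *m x^T) 0 0 = \sum_i \sum_j x 0 i * A i j * x 0 j.
Proof.
rewrite mxE exchange_big; apply: eq_bigr => j _ /=.
by rewrite !mxE mulr_suml; apply: eq_bigr.
Qed.

Lemma mx_sqnormE (R : comRingType) (n : nat) (x : 'rV[R]_n) :
  (x *m x^T) 0 0 = \sum_i x 0 i ^+ 2.
Proof. by rewrite mxE; apply: eq_bigr => i _; rewrite mxE expr2. Qed.

(** A variational Perron argument: as [A] has nonnegative entries, replacing an eigenvector for [r]
    by its absolute values keeps the norm and does not lower the form, which is then maximal. *)
Lemma positive_maximizer (R : realType) (n : nat) (A : 'M[R]_n) (r : R) :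
  A^T = A -> (forall i, 0 <= A i i) -> (forall i j, i != j -> 0 < A i j) ->
  is_largest_eigenvalue A r ->
  exists2 x : 'rV_n, forall i, 0 < x 0 i
    & (x *m A *m x^T) 0 0 = r * (x *m x^T) 0 0.
Proof.
move=> symA Adiag Aoff [/eigenvalueP[v vA v_neq0] r_max].
have A_ge0 i j : 0 <= A i j by have [->|/Aoff/ltW] := eqVneq i j.
pose y : 'rV_n := \row_i `|v 0 i|.
have y_ge0 i : 0 <= y 0 i by rewrite mxE normr_ge0.
have yA : (y *m A *m y^T) 0 0 = r * (y *m y^T) 0 0.
  apply/le_anti; rewrite rayleigh_le //=.
  have -> : r * (y *m y^T) 0 0 = (v *m A *m v^T) 0 0.
    rewrite vA -scalemxAl [RHS]mxE !mx_sqnormE; congr (_ * _).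
    by apply: eq_bigr => i _; rewrite mxE real_normK ?num_real.
  rewrite !mx_formE; apply: ler_sum => i _; apply: ler_sum => j _.
  by rewrite (le_trans (ler_norm _)) // !normrM (ger0_norm (A_ge0 _ _)) !mxE.
exists y => // i; rewrite lt_def y_ge0 andbT; apply/eqP => yi0.
have [j yj_gt0] : exists j, 0 < y 0 j.
  by have /rV0Pn[j vj] := v_neq0; exists j; rewrite mxE normr_gt0.
have neq_ji : j != i by apply: contraTneq yj_gt0 => ->; rewrite yi0 ltxx.
(* If y_i = 0, increasing the i-th entry of y raises the form to first order
   but the squared norm only to second order. *)
pose s := (y *m A) 0 i.
have s_gt0 : 0 < s.
  rewrite /s mxE (bigD1 j) //= ltr_wpDr ?mulr_gt0 ?Aoff //.
  by apply: sumr_ge0 => l _; rewrite mulr_ge0.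
(* The Rayleigh bound at [y + e d], with [d] the [i]-th unit vector: [y] attains the bound and
   [y_i = 0], so only terms in [e] and [e^2] remain. *)
have perturb e : 2 * e * s + e ^+ 2 * A i i <= r * e ^+ 2.
  pose d := delta_mx 0 i : 'rV[R]_n.
  have := rayleigh_le symA r_max (y + e *: d).
  have dd : (d *m d^T) 0 0 = 1.
    rewrite mx_sqnormE (bigD1 i) //= big1 => [|l /negPf li].
      by rewrite mxE !eqxx expr1n addr0.
    by rewrite mxE li andbF expr0n.
  have yd : (y *m d^T) 0 0 = 0.
    by rewrite trmx_delta -colE mxE.
  have dy : (d *m y^T) 0 0 = 0 by rewrite -rowE !mxE -yi0 mxE.
  have yAd : (y *m A *m d^T) 0 0 = s by rewrite trmx_delta -colE mxE.
  have dAy : (d *m A *m y^T) 0 0 = s.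
    rewrite -rowE /s !mxE; apply: eq_bigr => l _.
    by rewrite !mxE mulrC -[in LHS]symA mxE.
  have dAd : (d *m A *m d^T) 0 0 = A i i.
    by rewrite trmx_delta -colE -rowE !mxE.
  rewrite linearD linearZ /= !mulmxDl !mulmxDr -!scalemxAl -!scalemxAr.
  have mxD (M N : 'M[R]_1) : (M + N) 0 0 = M 0 0 + N 0 0 by rewrite mxE.
  have mxZ a (M : 'M[R]_1) : (a *: M) 0 0 = a * M 0 0 by rewrite mxE.
  rewrite !(mxD, mxZ) yA yd dy dd yAd dAy dAd.
  move=> H; nra.
(* For [e = s / c] the inequality reads [e^2 (2c - (r - A i i)) <= 0], which fails for every
   positive [c > r - A i i]. *)
pose c := `|r - A i i| + 1.
have c_gt0 : 0 < c by rewrite ltr_wpDl.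
have := perturb (s / c).
have ltc : r - A i i < c by rewrite (le_lt_trans (ler_norm _)) // ltrDl.
set e := s / c.
have e_gt0 : 0 < e by rewrite divr_gt0.
have sE : s = e * c by rewrite /e divfK // gt_eqF.
rewrite sE => H.
have : e ^+ 2 * (2 * c - (r - A i i)) <= 0 by nra.
rewrite leNgt mulr_gt0 ?exprn_gt0 //; lra.
Qed.

(** * Distances and their quadratic form *)

Section GraphBasics.
Variables (V : finType) (G : sgraph V).
Local Open Scope nat_scope.

Lemma edge_neq (u v : V) : edge G u v -> u != v.
Proof. by apply: contraTneq => ->; rewrite edge_irr. Qed.

Lemma dist_refl (u : V) : dist G u u = 0.
Proof. by apply/eqP; rewrite -leqn0 (dist_least (p := [::])). Qed.

Lemma dist_edge (u v : V) : edge G u v -> dist G u v <= 1.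
Proof. by move=> uv; rewrite (dist_least (p := [:: v])) //= uv. Qed.

Lemma dist_gt0 (u v : V) : connect (edge G) u v -> u != v -> 0 < dist G u v.
Proof.
move=> /dist_attained[[|w p] [_ lp <-]] //.
by rewrite -lp eqxx.
Qed.

(** The tool for bounding distances from below in a modified graph: [f] is a potential that grows by
    at most one along each edge. *)
Lemma dist_le_lipschitz (f : V -> nat) (u v : V) :
  connect (edge G) u v -> (forall x y, edge G x y -> f y <= f x + 1) ->
  f v <= f u + dist G u v.
Proof.
move=> /dist_attained[p [Gp <- <-]] lipf.
elim: p u Gp => [|w p IHp] u /=; first by rewrite addn0.
case/andP=> /lipf le_fwu /IHp; lia.
Qed.

Lemma pendantP (u : V) :
  reflect (exists w, forall x, edge G u x = (x == w)) (pendant G u).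
Proof.
apply: (iffP cards1P) => [[w Nu]|[w Nu]]; exists w.
  by move=> x; have /setP/(_ x) := Nu; rewrite !inE.
by apply/setP => x; rewrite !inE.
Qed.

Lemma pendant_nbr_eq (u a b : V) :
  pendant G u -> edge G u a -> edge G u b -> a = b.
Proof. by move=> /pendantP[w Nu]; rewrite !Nu => /eqP-> /eqP->. Qed.

Hypothesis connG : connected G.

Lemma dist_triangle (u v w : V) : dist G u w <= dist G u v + dist G v w.
Proof.
have [p [Gp pv <-]] := dist_attained (connG u v).
have [q [Gq qw <-]] := dist_attained (connG v w).
by rewrite -size_cat (dist_least (p := p ++ q)) ?cat_path ?last_cat ?pv ?Gp.
Qed.

Lemma dist_edge_lipschitz (u v w : V) : edge G v w -> dist G u w <= dist G u v + 1.
Proof. by move=> /dist_edge; have := dist_triangle u v w; lia. Qed.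

Lemma dist_ge2 (u v : V) : u != v -> ~~ edge G u v -> 1 < dist G u v.
Proof.
move=> uv nuv; have [[|w [|z p]] [/= Gp lp <-]] := dist_attained (connG u v) => //.
  by rewrite lp eqxx in uv.
by move: Gp nuv; rewrite lp andbT => ->.
Qed.

End GraphBasics.

(** Ordered pairs count each pair twice, so this is twice the quadratic form of the distance
    signless Laplacian. *)
Definition dist_energy (R : realType) (n : nat) (G : sgraph 'I_n) (x : 'rV[R]_n) : R :=
  \sum_i \sum_j (dist G i j)%:R * (x 0 i + x 0 j) ^+ 2.

Lemma dist_energyE (R : realType) (n : nat) (G : sgraph 'I_n) (x : 'rV[R]_n) :
  dist_energy G x = (x *m dist_signless_laplacian R G *m x^T) 0 0 *+ 2.
Proof.
have -> : (x *m dist_signless_laplacian R G *m x^T) 0 0 =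
  \sum_i (transmission G i)%:R * x 0 i ^+ 2
  + \sum_i \sum_j (dist G i j)%:R * x 0 i * x 0 j.
  rewrite mulmxDr mulmxDl mxE; congr (_ + _).
    rewrite /transmission_mx mul_mx_diag mxE; apply: eq_bigr => i _.
    by rewrite !mxE; ring.
  rewrite mx_formE; apply: eq_bigr => i _; apply: eq_bigr => j _.
  by rewrite !mxE; ring.
pose S := \sum_i \sum_j (dist G i j)%:R * x 0 i ^+ 2.
have S1 : \sum_i (transmission G i)%:R * x 0 i ^+ 2 = S.
  by apply: eq_bigr => i _; rewrite natr_sum mulr_suml.
have S2 : \sum_i \sum_j (dist G i j)%:R * x 0 j ^+ 2 = S.
  rewrite exchange_big; apply: eq_bigr => i _; apply: eq_bigr => j _.
  by rewrite dist_sym.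
rewrite S1 mulrnDl mulr2n -{2}S2 mulr2n -!big_split /=; apply: eq_bigr => i _.
rewrite -!big_split /=; apply: eq_bigr => j _; ring.
Qed.

(** [G] attains its Rayleigh bound at [x], and [G'] stays below its own, which is not larger. As [x]
    depends on [G] alone, several competitors can be compared at once. *)
Lemma rho_Q_test_vector (R : realType) (n : nat) (G : sgraph 'I_n) :
  (0 < n)%N -> connected G ->
  exists2 x : 'rV[R]_n, forall i, 0 < x 0 i
    & forall G' : sgraph 'I_n, rho_Q R G' <= rho_Q R G ->
        dist_energy G' x <= dist_energy G x.
Proof.
move=> n_gt0 connG.
have symQ (H : sgraph 'I_n) :
    (dist_signless_laplacian R H)^T = dist_signless_laplacian R H.
  rewrite linearD /= tr_diag_mx; congr (_ + _).
  by apply/matrixP => i j; rewrite !mxE dist_sym.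
have [] := positive_maximizer (symQ G) _ _ (rho_QP R G n_gt0).
- by move=> i; rewrite !mxE addr_ge0 // mulrn_wge0.
- move=> i j ij; rewrite !mxE (negPf ij) mulr0n add0r ltr0n.
  exact: dist_gt0.
move=> x x_gt0 xQ; exists x => // G' le_rho.
rewrite !dist_energyE lerMn2r /= xQ.
have [_ rho_max] := rho_QP R G' n_gt0.
apply: le_trans (rayleigh_le (symQ G') rho_max x) _.
rewrite ler_wpM2r // mx_sqnormE; apply: sumr_ge0 => i _; exact: sqr_ge0.
Qed.

(** * Edge deletion and branch moves *)

Section Surgery.
Variables (V : finType) (G : sgraph V).
Local Open Scope nat_scope.

(** Adjacency in [G - v], with [v] kept as an isolated vertex. *)
Definition avoiding (v x y : V) : bool := [&& edge G x y, x != v & y != v].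

Lemma avoiding_sym (v : V) : connect_sym (avoiding v).
Proof.
by apply: sym_connect_sym => x y; rewrite /avoiding edge_sym [(x != v) && _]andbC.
Qed.

(** Says that [v] lies on no cycle; for all [v] together, that [G] is a forest. *)
Definition separates_nbrs (v : V) : Prop := forall a b,
  edge G v a -> edge G v b -> connect (avoiding v) a b -> a = b.

Definition branch (v c x : V) : bool := (x != v) && connect (avoiding v) c x.

Definition is_pair (a b x y : V) : bool :=
  (x == a) && (y == b) || (x == b) && (y == a).

Lemma is_pair_sym (a b : V) : symmetric (is_pair a b).
Proof. by move=> x y; rewrite /is_pair orbC !(andbC (y == _)). Qed.

Definition delete_rel (a b x y : V) : bool := edge G x y && ~~ is_pair a b x y.

Lemma delete_rel_sym (a b : V) : symmetric (delete_rel a b).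
Proof. by move=> x y; rewrite /delete_rel edge_sym is_pair_sym. Qed.

Lemma delete_rel_irr (a b : V) : irreflexive (delete_rel a b).
Proof. by move=> x; rewrite /delete_rel edge_irr. Qed.

Definition delete_edge (a b : V) : sgraph V :=
  SGraph (delete_rel_sym a b) (delete_rel_irr a b).

Definition reattach_rel (v c a x y : V) : bool :=
  delete_rel v c x y || is_pair a c x y && (x != y).

Lemma reattach_rel_sym (v c a : V) : symmetric (reattach_rel v c a).
Proof.
by move=> x y; rewrite /reattach_rel is_pair_sym delete_rel_sym eq_sym.
Qed.

Lemma reattach_rel_irr (v c a : V) : irreflexive (reattach_rel v c a).
Proof. by move=> x; rewrite /reattach_rel delete_rel_irr eqxx andbF. Qed.

(* The edge vc is replaced by ac; the inequality x != y in reattach_rel only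
   matters in the degenerate case a = c. *)
Definition reattach (v c a : V) : sgraph V :=
  SGraph (reattach_rel_sym v c a) (reattach_rel_irr v c a).

Lemma delete_edge_sub (a b x y : V) : edge (delete_edge a b) x y -> edge G x y.
Proof. by case/andP. Qed.

(** * Deleting an edge of a cycle *)

Section DeleteCycleEdge.
Variables v a b : V.
Hypotheses (va : edge G v a) (vb : edge G v b) (ab : a != b).
Hypothesis conn_ab : connect (avoiding v) a b.

Lemma delete_edge_connected : connected G -> connected (delete_edge v a).
Proof.
move=> connG x y.
(* The rest of the cycle, from [a] through [G - v] to [b] and then to [v], replaces the deleted
   edge. *)
have av : connect (edge (delete_edge v a)) a v.
  apply: (@connect_trans _ _ b).
    apply: connect_sub conn_ab => z w /and3P[zw zv wv]; apply: connect1.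
    by rewrite /= /delete_rel zw /is_pair (negPf zv) (negPf wv) andbF.
  apply: connect1; rewrite /= /delete_rel edge_sym vb /is_pair eqxx andbT.
  by rewrite (negPf (edge_neq va)) andbF eq_sym.
apply: connect_sub (connG x y) => z w zw.
case zwva: (is_pair v a z w); last first.
  by apply: connect1; rewrite /= /delete_rel zw zwva.
have symD : connect_sym (edge (delete_edge v a)).
  by apply: sym_connect_sym; apply: edge_sym.
by case/orP: zwva => /andP[/eqP-> /eqP->] //; rewrite symD.
Qed.

(** Both ends of the deleted edge lie on a cycle, so a pendant vertex is neither of them and keeps
    its edge. *)
Lemma delete_edge_pendant (u : V) : pendant G u -> pendant (delete_edge v a) u.
Proof.
move=> pu; case/pendantP: (pu) => w Nu; apply/pendantP; exists w => x.
rewrite /= /delete_rel Nu andb_idr // => /eqP->.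
apply/norP; split; apply/negP => /andP[/eqP uE _].
  by move: ab; rewrite (pendant_nbr_eq pu (a := a) (b := b)) ?eqxx // uE.
case/connectP: conn_ab => -[|z p] /=; first by move=> _ /eqP; rewrite eq_sym (negPf ab).
case/andP => /and3P[az _ zv] _ _.
by move: zv; rewrite (pendant_nbr_eq pu (a := z) (b := v)) ?eqxx // uE // edge_sym.
Qed.

Lemma delete_edge_dist (x y : V) : connected G -> dist G x y <= dist (delete_edge v a) x y.
Proof.
move=> connG; have := @dist_le_lipschitz _ (delete_edge v a) (dist G x) x y.
rewrite dist_refl; apply; first exact: delete_edge_connected.
by move=> z w /delete_edge_sub; apply: dist_edge_lipschitz.
Qed.

Lemma delete_edge_dist_lt : connected G -> dist G v a < dist (delete_edge v a) v a.
Proof.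
move=> connG; apply: leq_trans (_ : 1 < _); first exact: dist_edge.
apply: dist_ge2; [exact: delete_edge_connected | exact: (edge_neq va) |].
by rewrite /= /delete_rel /is_pair !eqxx andbF.
Qed.

End DeleteCycleEdge.

(** * Branches at a vertex on no cycle *)

Section Branches.
Variable v : V.
Hypotheses (connG : connected G) (sepv : separates_nbrs v).

Lemma branch_root (c : V) : edge G v c -> branch v c c.
Proof. by move=> vc; rewrite /branch connect0 andbT eq_sym (edge_neq vc). Qed.

(** An edge leaving a component of [G - v] must end in [v], and by separation [c] is the only vertex
    of its component adjacent to [v]. *)
Lemma branch_exit (c x y : V) : edge G v c -> edge G x y ->
  branch v c x -> ~~ branch v c y -> x = c /\ y = v.
Proof.
move=> vc xy /andP[xv cx]; rewrite /branch negb_and negbK.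
have [yE|yv] /= := eqVneq y v => [_|/negP[]]; last first.
  by apply: connect_trans cx _; apply: connect1; rewrite /avoiding xy xv.
by split=> //; apply/esym/sepv => //; rewrite edge_sym -yE.
Qed.

Lemma branch_other_root (c a : V) :
  edge G v c -> edge G v a -> a != c -> ~~ branch v c a.
Proof.
by move=> vc va; apply: contraNN => /andP[_ /(sepv vc va)->].
Qed.

Lemma branch_disjoint (a b z : V) : edge G v a -> edge G v b -> a != b ->
  branch v a z -> ~~ branch v b z.
Proof.
move=> va vb ab /andP[_ az]; apply: contraNN ab => /andP[_ bz].
by apply/eqP/sepv => //; apply: connect_trans az _; rewrite avoiding_sym.
Qed.

(** Every path from [a] to [z] passes through [v]. The potential is [0] on the branch and equals [1]
    at [v], its only exit. *)
Lemma dist_outside_branch (a z : V) : edge G v a -> ~~ branch v a z ->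
  dist G v z + 1 <= dist G a z.
Proof.
move=> va /negPf zA.
have := @dist_le_lipschitz _ G
  (fun y => if branch v a y then 0 else dist G v y + 1) a z (connG _ _).
rewrite branch_root // zA add0n; apply=> x y xy.
have [Ay|nAy] := boolP (branch v a y); first by lia.
have [Ax|nAx] := boolP (branch v a x).
  by have [_ ->] := branch_exit va xy Ax nAy; rewrite dist_refl.
by have := dist_edge_lipschitz connG v xy; lia.
Qed.

(* The distance to z is convex along the path a, v, b: at most one of the
   branches at a and b contains z, and leaving the other one costs one step. *)
Lemma dist_convex_at (a b z : V) : edge G v a -> edge G v b -> a != b ->
  2 * dist G v z <= dist G a z + dist G b z.
Proof.
move=> va vb ab.
have la : dist G v z <= dist G a z + 1.
  by have := dist_triangle connG v a z; have := dist_edge va; lia.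
have lb : dist G v z <= dist G b z + 1.
  by have := dist_triangle connG v b z; have := dist_edge vb; lia.
have [Az|/(dist_outside_branch va)] := boolP (branch v a z); last by lia.
by have := dist_outside_branch vb (branch_disjoint va vb ab Az); lia.
Qed.

(** * Moving a branch to a neighbor *)

Section Reattach.
Variables c a : V.
Hypotheses (vc : edge G v c) (va : edge G v a) (ac : a != c).

Lemma reattach_connected : connected (reattach v c a).
Proof.
have symR : connect_sym (edge (reattach v c a)).
  by apply: sym_connect_sym; apply: edge_sym.
have cv : connect (edge (reattach v c a)) c v.
  apply: (@connect_trans _ _ a); apply: connect1 => /=.
    by rewrite /reattach_rel /is_pair !eqxx eq_sym ac !orbT.
  rewrite /reattach_rel /delete_rel edge_sym va /is_pair (negPf ac).
  by rewrite eq_sym (negPf (edge_neq va)).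
move=> x y; apply: connect_sub (connG x y) => z w zw.
case zwvc: (is_pair v c z w); last first.
  by apply: connect1; rewrite /= /reattach_rel /delete_rel zw zwvc.
by case/orP: zwvc => /andP[/eqP-> /eqP->] //; rewrite symR.
Qed.

(** [v] is not pendant, having the neighbors [a] and [c]; a pendant [c] exchanges [v] for [a]; among
    the other vertices only [a] can change its degree. *)
Lemma reattach_pendant (u : V) :
  pendant G u -> u != a -> pendant (reattach v c a) u.
Proof.
move=> pu ua; have uv : u != v.
  apply: contraNneq ac => uv; apply/eqP/(pendant_nbr_eq pu); by rewrite uv.
case/pendantP: (pu) => w Nu; apply/pendantP.
have [uc|uc] := eqVneq u c; last first.
  exists w => x.
  rewrite /= /reattach_rel /delete_rel /is_pair (negPf uv) (negPf uc) (negPf ua).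
  by rewrite Nu andbT orbF.
have Nc x : edge G u x = (x == v).
  by rewrite Nu; suff -> : w = v by []; apply/esym/eqP; rewrite -Nu uc edge_sym.
exists a => x; rewrite /= /reattach_rel /delete_rel /is_pair Nc.
rewrite (negPf uv) -uc (negPf ua) eqxx /=.
rewrite andbN /=; have [->|] //= := eqVneq x a.
Qed.

(** The moved branch is joined to the rest only by the edge [ac], so potentials on the two sides
    glue once they differ by at most one there. *)
Lemma reattach_lipschitz (g1 g2 : V -> nat) :
  (forall x y, edge G x y -> g1 y <= g1 x + 1) ->
  (forall x y, edge G x y -> g2 y <= g2 x + 1) ->
  g1 c <= g2 a + 1 -> g2 a <= g1 c + 1 ->
  forall x y, edge (reattach v c a) x y ->
  (if branch v c y then g1 y else g2 y)
    <= (if branch v c x then g1 x else g2 x) + 1.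
Proof.
move=> lip1 lip2 g12 g21 x y.
case/orP=> [/andP[xy xyvc]|/andP[/orP[]/andP[/eqP-> /eqP->] _]]; last 2 first.
- by rewrite branch_root // (negPf (branch_other_root vc va ac)).
- by rewrite branch_root // (negPf (branch_other_root vc va ac)).
have [Cx|nCx] := boolP (branch v c x); have [Cy|nCy] := boolP (branch v c y).
- exact: lip1.
- have [xc yv] := branch_exit vc xy Cx nCy.
  by rewrite /is_pair xc yv !eqxx orbT in xyvc.
- have [yc xv] := branch_exit vc (etrans (edge_sym G y x) xy) Cy nCx.
  by rewrite /is_pair yc xv !eqxx in xyvc.
- exact: lip2.
Qed.

(** The new distance is at least [d(y,c) + 1 + d(a,z)], the old one at most [d(y,c) + 1 + d(v,z)].
    The additive form avoids truncated subtraction. *)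
Lemma reattach_dist_across (y z : V) : branch v c y -> ~~ branch v c z ->
  dist G y z + dist G a z <= dist (reattach v c a) y z + dist G v z.
Proof.
move=> Cy nCz.
have := dist_le_lipschitz (reattach_connected y z)
  (@reattach_lipschitz (dist G y) (fun w => dist G y c + 1 + dist G a w) _ _ _ _).
rewrite Cy (negPf nCz) (dist_refl G y).
have yz : dist G y z <= dist G y c + 1 + dist G v z.
  have := dist_triangle connG y c z; have := dist_triangle connG c v z.
  by have := dist_edge vc; rewrite (dist_sym G c v); lia.
move=> H; suff : dist G y c + 1 + dist G a z <= 0 + dist (reattach v c a) y z by lia.
apply: H.
- by move=> u w; apply: dist_edge_lipschitz.
- by move=> u w /(dist_edge_lipschitz connG a); lia.
- by rewrite dist_refl; lia.
- by rewrite dist_refl; lia.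
Qed.

(** The potential is the old distance from [y] on the side of [y], extended across the edge [ac] by
    distances from its far end. *)
Lemma reattach_dist_same (y z : V) : branch v c y = branch v c z ->
  dist G y z <= dist (reattach v c a) y z.
Proof.
move=> Cyz; have [Cy|nCy] := boolP (branch v c y).
  have := dist_le_lipschitz (reattach_connected y z)
    (@reattach_lipschitz (dist G y) (fun w => dist G y c + 1 + dist G a w) _ _ _ _).
  rewrite -Cyz Cy (dist_refl G y); apply.
  - by move=> u w; apply: dist_edge_lipschitz.
  - by move=> u w /(dist_edge_lipschitz connG a); lia.
  - by rewrite dist_refl; lia.
  - by rewrite dist_refl; lia.
have := dist_le_lipschitz (reattach_connected y z)
  (@reattach_lipschitz (fun w => dist G y a + 1 + dist G c w) (dist G y) _ _ _ _).
rewrite -Cyz (negPf nCy) (dist_refl G y); apply.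
- by move=> u w /(dist_edge_lipschitz connG c); lia.
- by move=> u w; apply: dist_edge_lipschitz.
- by rewrite dist_refl; lia.
- by rewrite dist_refl; lia.
Qed.

End Reattach.

Lemma reattach_gain (a b c y z : V) :
  edge G v a -> edge G v b -> edge G v c -> a != b -> a != c -> b != c ->
  2 * dist G y z <= dist (reattach v c a) y z + dist (reattach v c b) y z.
Proof.
move=> va vb vc ab ac bc.
wlog lecyz : y z / branch v c z -> branch v c y.
  move=> IH; have [Cz|nCz] := boolP (branch v c z); last by apply: IH; rewrite (negPf nCz).
  rewrite dist_sym (dist_sym (reattach v c a)) (dist_sym (reattach v c b)).
  exact: IH.
have [Cyz|Cyz] := eqVneq (branch v c y) (branch v c z).
  by have := reattach_dist_same vc va ac Cyz; have := reattach_dist_same vc vb bc Cyz; lia.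
have [Cy nCz] : branch v c y /\ ~~ branch v c z.
  by move: Cyz lecyz; do 2![case: (branch _ _ _)] => // _ /(_ isT).
have := reattach_dist_across vc va ac Cy nCz.
have := reattach_dist_across vc vb bc Cy nCz.
by have := dist_convex_at z va vb ab; lia.
Qed.

(** Supplies the strict inequality in the comparison of energies: this pair gains [d(a,v) > 0]. *)
Lemma reattach_gain_root (a c : V) : edge G v a -> edge G v c -> a != c ->
  dist G c v < dist (reattach v c a) c v.
Proof.
move=> va vc ac.
have := reattach_dist_across vc va ac (branch_root vc) (z := v).
rewrite /branch eqxx dist_refl => /(_ isT).
by have := dist_gt0 (connG a v); rewrite eq_sym (edge_neq va) => /(_ isT); lia.
Qed.

End Branches.
End Surgery.

(** * Extremal graphs *)

Section SimplePaths.
Variables (V : finType) (G : sgraph V).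
Local Open Scope nat_scope.

Definition simple_path (s : seq V) : bool := sorted (edge G) s && uniq s.

Lemma simple_path_edge (x : V) (s : seq V) (i : nat) :
  simple_path s -> i.+1 < size s -> edge G (nth x s i) (nth x s i.+1).
Proof. by case/andP => /(sortedP x) Gs _; apply: Gs. Qed.

Lemma simple_path_inj (x : V) (s : seq V) (i j : nat) :
  simple_path s -> i < size s -> j < size s -> nth x s i = nth x s j -> i = j.
Proof. by case/andP => _ Us lti ltj /eqP; rewrite nth_uniq // => /eqP. Qed.

Lemma simple_path_inner (x : V) (s : seq V) (i : nat) :
  simple_path s -> i.+2 < size s ->
  [/\ edge G (nth x s i.+1) (nth x s i), edge G (nth x s i.+1) (nth x s i.+2)
    & nth x s i != nth x s i.+2].
Proof.
move=> Ps lti; have ltSi : i.+1 < size s by apply: ltnW.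
split; [by rewrite edge_sym simple_path_edge | exact: simple_path_edge |].
by apply/eqP => /(simple_path_inj Ps (ltnW ltSi) lti); lia.
Qed.

Lemma simple_path_inner_nonpendant (x : V) (s : seq V) (i : nat) :
  simple_path s -> i.+2 < size s -> ~~ pendant G (nth x s i.+1).
Proof.
move=> Ps /(simple_path_inner x Ps)[e1 e2]; apply: contraNN => pe.
by rewrite (pendant_nbr_eq pe e1 e2).
Qed.

Hypothesis connG : connected G.

Lemma connected_closed (P : V -> Prop) (x : V) :
  P x -> (forall y z, P y -> edge G y z -> P z) -> forall y, P y.
Proof.
move=> Px Pclosed y; have [p [Gp <- _]] := dist_attained (connG x y).
elim: p x Px Gp => //= z p IHp x Px /andP[xz]; apply: IHp; exact: Pclosed xz.
Qed.

(* A simple path between two pendant vertices through vertices of degree 2 is a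
   union of connected components. *)
Lemma max_degree2_pendants :
  (forall v a b c, edge G v a -> edge G v b -> edge G v c ->
     a != b -> a != c -> b != c -> False) ->
  #|[set v | pendant G v]| <= 2.
Proof.
move=> deg2; rewrite leqNgt; apply/negP => /card_gt2P[u [w [t [[]]]]].
rewrite !inE => pu pw pt [uw wt tu].
have /connectP[p0 Gp0 pw0] := connG u w.
move: uw wt pw; rewrite {}pw0; case/shortenP: Gp0 => p Gp Up _ uw wt pw.
pose s := u :: p.
have Ps : simple_path s by rewrite /simple_path /= Gp.
have sz : 1 < size s by rewrite /s; case: (p) uw => //=; rewrite eqxx.
have lastE : last u p = nth u s (size s).-1 by rewrite nth_last.
have inP y : y \in s.
  apply: (connected_closed (P := fun y => y \in s) (x := u)) => [|x z xs xz].
    exact: mem_head.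
  have [i lti xE] : exists2 i, i < size s & x = nth u s i.
    by exists (index x s); rewrite ?index_mem ?nth_index.
  case: i => [|i] in lti xE *.
    rewrite (pendant_nbr_eq pu (a := z) (b := nth u s 1)) ?mem_nth //.
      by rewrite -[u]/(nth u s 0) -xE.
    exact: (simple_path_edge u (i := 0) Ps).
  have [lti2|] := ltnP i.+2 (size s); last first.
    move=> gei; have iE : i.+1 = (size s).-1 by lia.
    rewrite (pendant_nbr_eq pw (a := z) (b := nth u s i)) ?mem_nth ?(ltnW lti) //.
      by rewrite lastE -iE -xE.
    by rewrite lastE -iE edge_sym simple_path_edge.
  have [e1 e2 n12] := simple_path_inner u Ps lti2.
  have [->|zi] := eqVneq z (nth u s i); first by rewrite mem_nth ?(ltnW lti).
  have [->|zi2] := eqVneq z (nth u s i.+2); first by rewrite mem_nth.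
  by case: (deg2 _ _ _ z e1 e2 _ n12); rewrite -?xE // eq_sym.
have [i lti tE] : exists2 i, i < size s & t = nth u s i.
  by exists (index t s); rewrite ?index_mem ?nth_index.
case: i => [|i] in lti tE *; first by rewrite tE eqxx in tu.
have [lti2|gei] := ltnP i.+2 (size s).
  by have := simple_path_inner_nonpendant u Ps lti2; rewrite -tE pt.
have iE : i.+1 = (size s).-1 by lia.
by rewrite tE iE -lastE eqxx in wt.
Qed.

End SimplePaths.

Section Extremal.
Variables (R : realType) (n k : nat).
Local Open Scope nat_scope.
Hypothesis n_gt0 : 0 < n.

(** A relaxed class, because edge deletions and moves may create new pendant vertices. *)
Definition at_least_pendants (G : sgraph 'I_n) : Prop :=
  connected G /\ k <= #|[set v | pendant G v]|.

(** Two competitors are taken together because a single move may shorten some distances. The weights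
    [(x_u + x_v)^2] are positive, so the comparison is term by term. *)
Lemma dist_energy_gain (G G1 G2 : sgraph 'I_n) (x : 'rV[R]_n) (i j : 'I_n) :
  (forall u, 0 < x 0 u)%R ->
  (forall u v, 2 * dist G u v <= dist G1 u v + dist G2 u v) ->
  2 * dist G i j < dist G1 i j + dist G2 i j ->
  (dist_energy G x *+ 2 < dist_energy G1 x + dist_energy G2 x)%R.
Proof.
move=> x_gt0 le2 lt2; rewrite -subr_gt0 -sumrMnl -big_split -sumrB /=.
have termE u v :
  ((dist G1 u v)%:R * (x 0 u + x 0 v) ^+ 2 + (dist G2 u v)%:R * (x 0 u + x 0 v) ^+ 2
    - ((dist G u v)%:R * (x 0 u + x 0 v) ^+ 2) *+ 2
   = ((dist G1 u v + dist G2 u v)%:R - (2 * dist G u v)%:R) * (x 0 u + x 0 v) ^+ 2 :> R)%R.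
  by rewrite natrD natrM; ring.
have term_ge0 u v : (0 <= ((dist G1 u v + dist G2 u v)%:R - (2 * dist G u v)%:R)
    * (x 0 u + x 0 v) ^+ 2 :> R)%R.
  by rewrite mulr_ge0 ?sqr_ge0 // subr_ge0 ler_nat.
rewrite (eq_bigr (fun u => \sum_v ((dist G1 u v + dist G2 u v)%:R
    - (2 * dist G u v)%:R) * (x 0 u + x 0 v) ^+ 2)%R); last first.
  move=> u _; rewrite -sumrMnl -big_split -sumrB /=.
  by apply: eq_bigr => v _; rewrite termE.
rewrite (bigD1 i) //= ltr_wpDr ?sumr_ge0 // => [u _|]; first exact: sumr_ge0.
rewrite (bigD1 j) //= ltr_wpDr ?sumr_ge0 //.
by rewrite mulr_gt0 ?subr_gt0 ?ltr_nat // exprn_gt0 // addr_gt0.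
Qed.

Variable G : sgraph 'I_n.
Hypothesis GS : at_least_pendants G.
Hypothesis Gmax : forall G', at_least_pendants G' -> (rho_Q R G' <= rho_Q R G)%R.

Lemma extremal_no_gain (G1 G2 : sgraph 'I_n) (i j : 'I_n) :
  at_least_pendants G1 -> at_least_pendants G2 ->
  (forall u v, 2 * dist G u v <= dist G1 u v + dist G2 u v) ->
  2 * dist G i j < dist G1 i j + dist G2 i j -> False.
Proof.
move=> S1 S2 le2 lt2; have [x x_gt0 Ex] := rho_Q_test_vector R n_gt0 (proj1 GS).
have := dist_energy_gain x_gt0 le2 lt2; apply/negP; rewrite -leNgt mulr2n.
by rewrite lerD // Ex // Gmax.
Qed.

Lemma extremal_separates (v : 'I_n) : separates_nbrs G v.
Proof.
case: GS => connG leP a b va vb conn_ab; apply/eqP; apply/negPn/negP => ab.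
have S' : at_least_pendants (delete_edge G v a).
  split; first exact: delete_edge_connected vb ab conn_ab connG.
  apply: leq_trans leP (subset_leq_card _); apply/subsetP => u; rewrite !inE.
  exact: delete_edge_pendant vb ab conn_ab _.
(* Deletion shortens no distance, so one graph serves as both competitors. *)
apply: (extremal_no_gain (i := v) (j := a) S' S') => [u w|].
  by have := delete_edge_dist va vb ab conn_ab u w connG; lia.
by have := delete_edge_dist_lt va vb ab conn_ab connG; lia.
Qed.

(** If the conclusion fails, either [a] and [b] are both non-pendant or there is a pendant vertex to
    spare, so both moves of the branch at [c] stay in the class. *)
Lemma extremal_branching (v a b c : 'I_n) :
  edge G v a -> edge G v b -> edge G v c -> a != b -> a != c -> b != c ->
  (pendant G a || pendant G b) && (#|[set u | pendant G u]| <= k).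
Proof.
move=> va vb vc ab ac bc; case: GS => connG leP.
have sepv := @extremal_separates v.
have reattachS w : edge G v w -> w != c ->
    ~~ pendant G w || (k < #|[set u | pendant G u]|) ->
    at_least_pendants (reattach G v c w).
  move=> vw wc pw; split; first exact: reattach_connected.
  have sub : [set u | pendant G u] :\ w \subset [set u | pendant (reattach G v c w) u].
    apply/subsetP => u; rewrite !inE => /andP[uw pu]; exact: reattach_pendant.
  apply: leq_trans (subset_leq_card sub).
  by move: pw leP; rewrite (cardsD1 w) inE; case: pendant => //=; lia.
apply/negPn/negP; rewrite negb_and negb_or -ltnNge => H.
apply: (extremal_no_gain (G1 := reattach G v c a) (G2 := reattach G v c b) (i := c) (j := v)).
- by apply: reattachS => //; case/orP: H => [/andP[->]|->]; rewrite ?orbT.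
- by apply: reattachS => //; case/orP: H => [/andP[_ ->]|->]; rewrite ?orbT.
- by move=> y z; apply: reattach_gain.
have := reattach_gain_root connG sepv va vc ac.
have := reattach_gain_root connG sepv vb vc bc; lia.
Qed.

Lemma extremal_pendants : 2 <= k -> #|[set u | pendant G u]| = k.
Proof.
move=> k2; case: GS => connG leP; apply/eqP; rewrite eqn_leq leP andbT leqNgt.
apply/negP => ltk; have := max_degree2_pendants connG; rewrite leqNgt (leq_ltn_trans k2 ltk).
move=> H; suff: false by []; apply: H => v a b c va vb vc ab ac bc.
by have := extremal_branching va vb vc ab ac bc; rewrite leqNgt ltk andbF.
Qed.

End Extremal.

(** * Recognizing the tree *)

Section Broom.
Variables (V : finType) (G : sgraph V).
Local Open Scope nat_scope.
Hypotheses (connG : connected G) (sepG : forall v, separates_nbrs G v).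
Hypothesis branching : forall v a b c,
  edge G v a -> edge G v b -> edge G v c -> a != b -> a != c -> b != c ->
  pendant G a || pendant G b.
Hypothesis two_inner : 2 <= #|[set v | ~~ pendant G v]|.

Lemma nonpendant_other (x y : V) :
  ~~ pendant G x -> edge G x y -> exists2 z, edge G x z & z != y.
Proof.
rewrite /pendant /degree => dx xy.
have : 0 < #|[set u | edge G x u] :\ y|.
  by move: dx; rewrite (cardsD1 y) inE xy; lia.
by case/card_gt0P => z; rewrite !inE => /andP[zy xz]; exists z.
Qed.

(** If all neighbors of a non-pendant [x] were pendant, the connected graph would be a star with
    center [x], without a second non-pendant vertex. *)
Lemma adjacent_inner : exists x y,
  [/\ edge G x y, ~~ pendant G x & ~~ pendant G y].
Proof.
have /card_gt1P[x [y [px py xy]]] := two_inner; rewrite !inE in px py.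
have [/existsP[z /andP[xz pz]]|/existsPn leaves] :=
  boolP [exists z, edge G x z && ~~ pendant G z]; first by exists x, z.
have leaf z : edge G x z -> pendant G z.
  by move=> xz; have := leaves z; rewrite xz negbK.
case: (connected_closed connG (P := fun z => z = x \/ edge G x z) (x := x) _ _ y).
- by left.
- move=> z w [->|xz] zw; [by right | left].
  by apply: (pendant_nbr_eq (leaf z xz) zw); rewrite edge_sym.
- by move=> yx; rewrite yx eqxx in xy.
by move=> /leaf; rewrite (negPf py).
Qed.

(** An edge between non-pendant vertices is extended at both ends; the new end vertices differ,
    since separation excludes triangles. *)
Lemma simple_path4 : exists2 s, simple_path G s & size s = 4.
Proof.
have [x [y [xy px py]]] := adjacent_inner.
have [x' xx' x'y] := nonpendant_other px xy.
have yx : edge G y x by rewrite edge_sym.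
have [y' yy' y'x] := nonpendant_other py yx.
exists [:: x'; x; y; y'] => //; rewrite /simple_path /= xy yy' edge_sym xx' /=.
rewrite !inE !negb_or x'y (edge_neq xy) (edge_neq yy') eq_sym (edge_neq xx').
rewrite [x == _]eq_sym y'x /= !andbT; apply: contraNneq x'y => x'y'.
apply/eqP/(@sepG x) => //; apply: connect1; rewrite /avoiding x'y' edge_sym yy' y'x.
by rewrite eq_sym (edge_neq xy).
Qed.

Lemma longest_simple_path : exists s : seq V, [/\ simple_path G s, 4 <= size s
  & forall s', simple_path G s' -> size s' <= size s].
Proof.
pose P m := [exists t : m.-tuple V, simple_path G t].
have inP s : simple_path G s -> P (size s).
  by move=> Ps; apply/existsP; exists (in_tuple s).
have [s4 Ps4 s4E] := simple_path4.
have exP : exists m, P m by exists (size s4); apply: inP.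
have leP m : P m -> m <= #|V|.
  case/existsP => t /andP[_ Ut]; rewrite -(size_tuple t) -(card_uniqP Ut).
  exact: max_card.
case: (ex_maxnP exP leP) => m /existsP[t Pt] maxm.
exists t; rewrite size_tuple; split=> // [|s' /inP]; last exact: maxm.
by rewrite -s4E; apply: maxm; apply: inP.
Qed.

(** The inner vertices of a longest path form the path of the tree. Its two ends and all vertices
    off it are pendant and attached to the first or last inner vertex. *)
Lemma broom_structure : exists l t1 t2 : nat,
  [/\ 0 < t1, 0 < t2, l + (t1 + t2) = #|V|,
      t1 + t2 = #|[set v | pendant G v]| & graph_iso G (path_with_pendants l t1 t2)].
Proof.
have [s [Ps sz4 maxs]] := longest_simple_path.
have [x0 _] : exists x, x \in s by case: (s) sz4 => // x r _; exists x; apply: mem_head.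
(* With this size the inner vertices are [p 1] to [p l.+2]. *)
have [l szs] : exists l, size s = l.+4 by exists (size s - 4); lia.
pose p i := nth x0 s i.
have p_edge i : i < l.+3 -> edge G (p i) (p i.+1).
  by move=> lti; apply: simple_path_edge; rewrite ?szs.
have p_inj i j : i < l.+4 -> j < l.+4 -> p i = p j -> i = j.
  by rewrite -szs => lti ltj; apply: (simple_path_inj Ps).

have p_neq i j : i < l.+4 -> j < l.+4 -> i <> j -> p i != p j.
  by move=> lti ltj ij; apply/eqP => /(p_inj _ _ lti ltj).
have p_mem y : y \in s -> exists2 j, j < l.+4 & y = p j.
  by rewrite -szs => ys; exists (index y s); rewrite ?index_mem // /p nth_index.
have p_inner i : i < l.+2 -> ~~ pendant G (p i.+1).
  by move=> lti; apply: simple_path_inner_nonpendant; rewrite ?szs.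
(* No chords: the path joins [p i.+1] to [p j] while avoiding [p i], so as neighbors of [p i] they
   coincide. *)
have chord i j : i < j -> j < l.+4 -> edge G (p i) (p j) -> j = i.+1.
  move=> ltij ltj pij; have lti : i < l.+3 by lia.
  have conn d : i.+1 + d < l.+4 -> connect (avoiding G (p i)) (p i.+1) (p (i.+1 + d)).
    elim: d => [|d IHd] ltd; first by rewrite addn0.
    have ltd' : i.+1 + d < l.+4 by lia.
    apply: connect_trans (IHd ltd') _; rewrite addnS; apply: connect1.
    by rewrite /avoiding p_edge ?p_neq //; lia.
  apply/esym/p_inj; [by lia | by [] |].
  apply: (@sepG (p i)) => //; first exact: p_edge.
  by have := conn (j - i.+1); rewrite subnKC //; apply.
have p_adj i j : i < l.+4 -> j < l.+4 ->
    edge G (p i) (p j) = (i.+1 == j) || (j.+1 == i).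
  move=> lti ltj; apply/idP/orP => [|[/eqP E|/eqP E]]; last 2 first.
  - by rewrite -E; apply: p_edge; lia.
  - by rewrite edge_sym -E; apply: p_edge; lia.
  case: (ltngtP i j) => [ij|ji|->]; last by rewrite edge_irr.
    by move=> /(chord _ _ ij ltj) ->; left.
  by rewrite edge_sym => /(chord _ _ ji lti) ->; right.
have [Gs Us] := andP Ps.
(* A neighbor off the path would prolong it; one on the path is [p 1], as there are no chords. *)
have first_nbr y : edge G (p 0) y -> y = p 1.
  move=> py; have : y \in s.
    apply/negPn/negP => ys; have := maxs (y :: s); rewrite /= ltnn => /(_ _) H.
    suff: false by []; apply: H; rewrite /simple_path /= ys Us andbT.
    by move: Gs py; rewrite /p; case: (s) szs => //= z r _ ->; rewrite edge_sym => ->.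
  case/p_mem => j ltj yE; rewrite yE in py *.
  by move: py; rewrite p_adj // orbF => /eqP <-.
have last_nbr y : edge G (p l.+3) y -> y = p l.+2.
  move=> py; have : y \in s.
    apply/negPn/negP => ys; have := maxs (rcons s y); rewrite size_rcons ltnn => H.
    suff: false by []; apply: H; rewrite /simple_path rcons_uniq ys Us andbT.
    move: Gs py; rewrite /p; case: (s) szs => //= z r [szr] Gr.
    by rewrite rcons_path Gr (last_nth x0) szr andbT.
  case/p_mem => j ltj yE; rewrite yE in py *.
  move: py; rewrite p_adj // => /orP[|/eqP[<-]//]; lia.
have pend_first : pendant G (p 0).
  apply/pendantP; exists (p 1) => y; apply/idP/eqP => [/first_nbr//|->].
  exact: p_edge.
have pend_last : pendant G (p l.+3).
  apply/pendantP; exists (p l.+2) => y; apply/idP/eqP => [/last_nbr//|->].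
  by rewrite edge_sym p_edge.
have nbrs i y : i < l.+2 -> edge G (p i.+1) y ->
    (exists2 j, j < l.+2 & y = p j.+1)
    \/ pendant G y /\ (i = 0 \/ i = l.+1).
  move=> lti py.
  have [->|y1] := eqVneq y (p i).
    case: i lti {py} => [|i] lti; first by right; split; [|left].
    by left; exists i => //; lia.
  have [->|y2] := eqVneq y (p i.+2).
    have [->|ltl] := eqVneq i l.+1; first by right; split; [|right].
    by left; exists i.+1 => //; lia.
  have e0 : edge G (p i.+1) (p i) by rewrite edge_sym p_edge //; lia.
  have e2 : edge G (p i.+1) (p i.+2) by rewrite p_edge.
  have n02 : p i != p i.+2 by rewrite p_neq //; lia.
  (* [p i], [p i.+2] and [y] are three neighbors, and one of the first two is inner, so [branching]
     makes [y] pendant. *)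
  right; split.
    case: i lti py y1 y2 e0 e2 n02 => [|i] lti py y1 y2 e0 e2 n02.
      have := branching e2 py e0; rewrite (negPf (p_inner 1 _)) //.
      by apply; rewrite // eq_sym.
    have := branching e0 py e2; rewrite (negPf (p_inner i _)); last by lia.
    by apply; rewrite // eq_sym.
  case: i lti py y1 y2 e0 e2 n02 => [|i] lti py y1 y2 e0 e2 n02; first by left.
  (* Away from both ends the two path neighbors are non-pendant, against [branching] with third
     neighbor [y]. *)
  right; apply/eqP/negPn/negP => il.
  have := branching e0 e2 py n02; rewrite (negPf (p_inner i _)); last by lia.
  rewrite (negPf (p_inner i.+2 _)); last by lia.
  by rewrite ![_ == y]eq_sym => /(_ y1 y2).
pose L1 := [set y | pendant G y && edge G (p 1) y].
pose L2 := [set y | pendant G y && edge G (p l.+2) y].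
(* The set described contains [p 1] and is closed under adjacency, so by connectedness it is
   everything. *)
have cover y : [\/ exists2 j, j < l.+2 & y = p j.+1, y \in L1 | y \in L2].
  apply: (connected_closed connG (x := p 1)
    (P := fun y => [\/ exists2 j, j < l.+2 & y = p j.+1, y \in L1 | y \in L2])).
    by apply: Or31; exists 0.
  move=> {}y z [[j ltj ->] pz||].
  - have [[i lti ->]|[lz [jE|jE]]] := nbrs j z ltj pz.
    + by apply: Or31; exists i.
    + by apply: Or32; rewrite inE lz -[1]/(0.+1) -jE.
    + by apply: Or33; rewrite inE lz -[l.+2]/(l.+1.+1) -jE.
  - rewrite inE => /andP[py e1] yz; apply: Or31; exists 0 => //.
    by apply: pendant_nbr_eq py yz _; rewrite edge_sym.
  - rewrite inE => /andP[py e1] yz; apply: Or31; exists l.+1 => //.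
    by apply: pendant_nbr_eq py yz _; rewrite edge_sym.
have L1_pend y : y \in L1 -> pendant G y by rewrite inE => /andP[].
have L2_pend y : y \in L2 -> pendant G y by rewrite inE => /andP[].
have L1_adj y x : y \in L1 -> edge G x y = (x == p 1).
  rewrite inE => /andP[py e1]; apply/idP/eqP => [xy|->//].
  by apply: (pendant_nbr_eq py); rewrite edge_sym.
have L2_adj y x : y \in L2 -> edge G x y = (x == p l.+2).
  rewrite inE => /andP[py e1]; apply/idP/eqP => [xy|->//].
  by apply: (pendant_nbr_eq py); rewrite edge_sym.
have disj y : y \in L1 -> y \in L2 -> False.
  move=> y1 y2; have := L1_adj y (p l.+2) y1; rewrite L2_adj // eqxx => /esym/eqP.
  by move/p_inj; lia.
have [L1p L2p] : p 0 \in L1 /\ p l.+3 \in L2.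
  by rewrite !inE pend_first pend_last edge_sym !p_edge.
(* Index [i] goes to [p i.+1], since [p 0] and [p l.+3] count among the leaves in [L1] and [L2]. *)
pose g (x : tree_vertex l.+2 #|L1| #|L2|) : V :=
  match x with
  | inl i => p i.+1
  | inr (inl a) => enum_val a
  | inr (inr b) => enum_val b
  end.
have g_edge x y : edge G (g x) (g y) = tree_edge x y.
  have L_inner i z : i < l.+2 -> (z \in L1 \/ z \in L2) -> p i.+1 <> z.
    by move=> lti [/L1_pend|/L2_pend] pz E; rewrite -E (negPf (p_inner i lti)) in pz.
  case: x y => [i|[a|b]] [j|[c|d]] /=.
  - by rewrite p_adj // ltnS (leq_trans (ltn_ord _)).
  - rewrite L1_adj ?enum_valP //; apply/eqP/eqP => [/p_inj|->//].
    by have := ltn_ord i; lia.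
  - rewrite L2_adj ?enum_valP //; apply/eqP/eqP => [/p_inj|[->]//].
    by have := ltn_ord i; lia.
  - rewrite edge_sym L1_adj ?enum_valP //; apply/eqP/eqP => [/p_inj|->//].
    by have := ltn_ord j; lia.
  - rewrite L1_adj ?enum_valP //; apply/eqP => /esym.
    by apply: L_inner; [|left; apply: enum_valP].
  - rewrite L2_adj ?enum_valP //; apply/eqP => /esym.
    by apply: L_inner; [|left; apply: enum_valP].
  - rewrite edge_sym L2_adj ?enum_valP //; apply/eqP/eqP => [/p_inj|[->]//].
    by have := ltn_ord j; lia.
  - rewrite L1_adj ?enum_valP //; apply/eqP => /esym.
    by apply: L_inner; [|right; apply: enum_valP].
  - rewrite L2_adj ?enum_valP //; apply/eqP => /esym.
    by apply: L_inner; [|right; apply: enum_valP].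
have g_inj : injective g.
  have pL i z : i < l.+2 -> pendant G z -> p i.+1 = z -> False.
    by move=> lti pz E; rewrite -E (negPf (p_inner i lti)) in pz.
  move=> [i|[a|b]] [j|[c|d]] /=.
  - move/p_inj => H; congr inl; apply/val_inj => /=.
    by have := ltn_ord i; have := ltn_ord j; lia.
  - by move/pL => []//; apply/L1_pend/enum_valP.
  - by move/pL => []//; apply/L2_pend/enum_valP.
  - by move/esym/pL => []//; apply/L1_pend/enum_valP.
  - by move/enum_val_inj->.
  - by move=> E; case: (disj (enum_val a) (enum_valP a)); rewrite E enum_valP.
  - by move/esym/pL => []//; apply/L2_pend/enum_valP.
  - by move=> E; case: (disj (enum_val c) (enum_valP c)); rewrite -E enum_valP.
  - by move/enum_val_inj->.
have g_surj y : y \in codom g.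
  apply/codomP; have [[j ltj ->]|y1|y2] := cover y.
  - by exists (inl (Ordinal ltj)).
  - by exists (inr (inl (enum_rank_in y1 y))); rewrite /= enum_rankK_in.
  - by exists (inr (inr (enum_rank_in y2 y))); rewrite /= enum_rankK_in.
(* [graph_iso] asks for a map out of [G], hence the inverse of [g]. *)
pose f y := iinv (g_surj y).
have fK : cancel f g by move=> y; apply: f_iinv.
have gK : cancel g f by move=> x; apply: g_inj; rewrite fK.
exists l.+2, #|L1|, #|L2|; split.
- by apply/card_gt0P; exists (p 0).
- by apply/card_gt0P; exists (p l.+3).
- by rewrite -(bij_eq_card (Bijective gK fK)) !card_sum !card_ord.
- have L12 : L1 :&: L2 = set0.
    by apply/setP => y; rewrite !inE; apply/negP => /andP[y1 y2]; apply: (disj y); rewrite inE.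
  rewrite -[LHS]subn0 -(cards0 V) -L12 -cardsU; apply: eq_card => y.
  rewrite in_setU [RHS]inE; apply/orP/idP => [[/L1_pend|/L2_pend]|py] //.
  case: (cover y) => [[j ltj yE]||]; [|by left|by right].
  by move: py; rewrite yE (negPf (p_inner j ltj)).
exists f; first by exists g.
by move=> u v; rewrite /= -g_edge !fK.
Qed.

End Broom.

(** * Existence of a maximizer *)

Lemma sgraph_ext (V : finType) (G H : sgraph V) : edge G =2 edge H -> G = H.
Proof.
case: G => e sym irr; case: H => e' sym' irr' /= ee'.
have E : e = e' by apply/funext => x; apply/funext => y.
by case: _ / E sym' irr' {ee'} => sym' irr'; congr SGraph; apply: Prop_irrelevance.
Qed.

Section GraphOfSet.
Variables (V : finType) (E : {set V * V}).

(** Loops are dropped and pairs symmetrized, so that every set of pairs codes a graph. *)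
Definition rel_of_set (x y : V) : bool :=
  (x != y) && (((x, y) \in E) || ((y, x) \in E)).

Lemma rel_of_set_sym : symmetric rel_of_set.
Proof. by move=> x y; rewrite /rel_of_set eq_sym orbC. Qed.

Lemma rel_of_set_irr : irreflexive rel_of_set.
Proof. by move=> x; rewrite /rel_of_set eqxx. Qed.

Definition graph_of_set : sgraph V := SGraph rel_of_set_sym rel_of_set_irr.

End GraphOfSet.

Lemma graph_of_setK (V : finType) (G : sgraph V) :
  graph_of_set [set u | edge G u.1 u.2] = G.
Proof.
apply: sgraph_ext => x y; rewrite /= /rel_of_set !inE /= [edge G y x]edge_sym orbb.
by rewrite andb_idl // => /edge_neq.
Qed.

(** Graphs are coded by the finite type of edge sets, where a maximum exists; [P] is made boolean
    classically. *)
Lemma sgraph_arg_max (R : realType) (V : finType) (P : sgraph V -> Prop)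
    (F : sgraph V -> R) (G : sgraph V) :
  P G -> exists2 H, P H & forall G', P G' -> F G' <= F H.
Proof.
move=> PG; pose Q (E : {set V * V}) := `[< P (graph_of_set E) >].
have QG : Q [set u | edge G u.1 u.2] by apply/asboolP; rewrite graph_of_setK.
case: (arg_maxP (fun E => F (graph_of_set E)) QG) => E /asboolP PE maxE.
exists (graph_of_set E) => // G' PG'; rewrite -(graph_of_setK G'); apply: maxE.
by apply/asboolP; rewrite graph_of_setK.
Qed.

(** * From exactly [k] to at least [k] pendant vertices, and the shape of a maximal graph *)

Theorem theorem3p5 (R : realType) (n k : nat) (hkn : (2 <= k <= n - 2)%N)
    (G : sgraph 'I_n) (hG : graphs_with_pendants k G)
    (hmax : forall G' : sgraph 'I_n, graphs_with_pendants k G' ->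
      rho_Q R G' <= rho_Q R G) :
  exists t1 t2 : nat,
    [/\ (1 <= t1)%N, (1 <= t2)%N, (t1 + t2 = k)%N & graph_iso G (T n k t1 t2)].
Proof.
have [k2 kn] := andP hkn; have n_gt0 : (0 < n)%N by lia.
have [connG pendG] := hG.
have SG : at_least_pendants k G by split; rewrite ?pendG.
(* A maximizer [H] of the relaxed class has exactly [k] pendant vertices, so its radius is at most
   that of [G], and [G] is maximal in the relaxed class too. *)
have [H SH Hmax] := sgraph_arg_max (rho_Q R (n := n)) SG.
have pendH := extremal_pendants n_gt0 SH Hmax k2.
have Gmax (G' : sgraph 'I_n) : at_least_pendants k G' -> rho_Q R G' <= rho_Q R G.
  move=> SG'; apply: le_trans (Hmax _ SG') _.
  by apply: hmax; split; first by case: SH.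
have inner : (2 <= #|[set v | ~~ pendant G v]|)%N.
  have := cardsC [set v | pendant G v]; rewrite pendG card_ord.
  have -> : ~: [set v | pendant G v] = [set v | ~~ pendant G v].
    by apply/setP => v; rewrite !inE.
  by lia.
have branchG v a b c va vb vc ab ac bc :=
  proj1 (andP (@extremal_branching R n k n_gt0 G SG Gmax v a b c va vb vc ab ac bc)).
have [l [t1 [t2 [t1_gt0 t2_gt0 ltn ltk isoG]]]] :=
  broom_structure connG (extremal_separates n_gt0 SG Gmax) branchG inner.
exists t1, t2; rewrite ltk pendG; split=> //.
rewrite /T; suff <- : l = (n - k)%N by [].
by move: ltn; rewrite card_ord ltk pendG; lia.
Qed.
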